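(* Let $J$ be a type $(1,1)$ tensor field on $Q$, $J^c$ its complete lift to $TQ$ and $S$ the vertical endomorphism on $TQ$. Then $(J^cS)^2=0$ and $N_{J^cS}=0$. Furthermore, if $J$ is non-singular, $J^cS$ determines an integrable almost tangent structure on $TQ$.
   Context: $Q$ is a smooth $n$-dimensional manifold. For a vector field $X$ on $Q$, $X^c$ and $X^V$ denote its complete and vertical lifts to $TQ$. $J^c$ is the type $(1,1)$ tensor field on $TQ$ with $J^c(X^c)=(JX)^c$, $J^c(X^V)=(JX)^V$. $S$ is the type $(1,1)$ tensor field on $TQ$ with $S(X^c)=X^V$, $S(X^V)=0$. $J^cS$ is the composition of endomorphisms. The Nijenhuis torsion of a type $(1,1)$ tensor field $K$ is $N_K(\xi,\eta)=[K\xi,K\eta]+K^2[\xi,\eta]-K([K\xi,\eta]+[\xi,K\eta])$. An almost tangent structure on a manifold is a type $(1,1)$ tensor field $K$ with $\ker K=\mathrm{im}\,K$ at every point; it is integrable if its Nijenhuis torsion $N_K$ vanishes. *)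

(* Defs.v *)
From HB Require Import structures.
From mathcomp Require Import all_boot all_order all_algebra.
From mathcomp Require Import all_classical all_reals all_analysis.

Set Implicit Arguments.
Unset Strict Implicit.
Unset Printing Implicit Defensive.

Import Order.TTheory GRing.Theory Num.Theory.
Import numFieldNormedType.Exports.

Local Open Scope classical_set_scope.
Local Open Scope ring_scope.

(* Meant for A open. In finite dimension this is the usual C^k: f is C^(k+1)
   iff it is differentiable with all directional derivatives C^k. *)
Fixpoint Ck_on (R : realType) (V W : normedModType R) (A : set V) (k : nat)
    (f : V -> W) : Prop :=
  if k is k'.+1 then
    (forall x, A x -> differentiable f x) /\ (forall v, Ck_on A k' ('D_v f))
  else forall x, A x -> {for x, continuous f}.

Definition smooth_on (R : realType) (V W : normedModType R) (A : set V)
    (f : V -> W) : Prop := forall k, Ck_on A k f.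

(* The data of an atlas; the axioms are in [is_manifold]. Only the values of
   [phi i] on [dom i] and of [psi i] on [phi i @` dom i] matter. The choice
   [chart_at p] of a chart around p serves to represent tangent vectors at p. *)
Record atlas (R : realType) (n : nat) := Atlas {
  point :> topologicalType;
  index : Type;
  dom : index -> set point;
  phi : index -> point -> 'rV[R]_n;
  psi : index -> 'rV[R]_n -> point;
  chart_at : point -> index
}.

Record is_manifold (R : realType) (n : nat) (M : atlas R n) : Prop := {
  manifold_hausdorff : hausdorff_space M;
  manifold_second_countable : @second_countable M;
  dom_chart_at : forall p : M, dom (chart_at p) p;
  dom_open : forall i : index M, open (dom i);
  phi_dom_open : forall i : index M, open (phi i @` dom i);
  phiK : forall (i : index M) p, dom i p -> psi i (phi i p) = p;
  phi_continuous : forall (i : index M) p, dom i p ->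
    {for p, continuous (phi i)};
  psi_continuous : forall (i : index M) x, (phi i @` dom i) x ->
    {for x, continuous (@psi _ _ M i)};
  transition_smooth : forall i j : index M,
    smooth_on (phi i @` (dom i `&` dom j)) (phi j \o psi i)
}.

(* T_p M is 'rV[R]_n: a tangent vector at p is represented by its components in
   the chart [chart_at p]. [to_chart i p v] gives its components in any chart i
   around p, and [of_chart i p] is the inverse. *)
Definition to_chart (R : realType) (n : nat) (M : atlas R n) (i : index M)
    (p : M) (v : 'rV[R]_n) : 'rV[R]_n :=
  v *m jacobian (phi i \o psi (chart_at p)) (phi (chart_at p) p).

Definition of_chart (R : realType) (n : nat) (M : atlas R n) (i : index M)
    (p : M) (w : 'rV[R]_n) : 'rV[R]_n :=
  w *m jacobian (phi (chart_at p) \o psi i) (phi i p).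

(* X p is an element of T_p M. *)
Definition vfield (R : realType) (n : nat) (M : atlas R n) : Type :=
  M -> 'rV[R]_n.

Definition vfield_rep (R : realType) (n : nat) (M : atlas R n) (X : vfield M)
    (i : index M) (x : 'rV[R]_n) : 'rV[R]_n :=
  to_chart i (psi i x) (X (psi i x)).

Definition smooth_vfield (R : realType) (n : nat) (M : atlas R n)
    (X : vfield M) : Prop :=
  forall i, smooth_on (phi i @` dom i) (vfield_rep X i).

(* K p is an endomorphism of T_p M. *)
Definition tensor11 (R : realType) (n : nat) (M : atlas R n) : Type :=
  M -> 'End('rV[R]_n).

(* For w ranging over the canonical basis, the maps below are the rows of the
   matrix of K in the chart i. *)
Definition smooth_tensor11 (R : realType) (n : nat) (M : atlas R n)
    (K : tensor11 M) : Prop :=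
  forall (i : index M) (w : 'rV[R]_n), smooth_on (phi i @` dom i)
    (fun x => to_chart i (psi i x) (K (psi i x) (of_chart i (psi i x) w))).

Definition tensor_app (R : realType) (n : nat) (M : atlas R n)
    (K : tensor11 M) (X : vfield M) : vfield M := fun p => K p (X p).

Definition tensor_comp (R : realType) (n : nat) (M : atlas R n)
    (K L : tensor11 M) : tensor11 M := fun p => (K p \o L p)%VF.

(* [X, Y]^k = X^j d_j Y^k - Y^j d_j X^k, in the chart [chart_at p]. *)
Definition bracket (R : realType) (n : nat) (M : atlas R n)
    (X Y : vfield M) : vfield M := fun p =>
  let c := chart_at p in
  'D_(X p) (vfield_rep Y c) (phi c p) - 'D_(Y p) (vfield_rep X c) (phi c p).

Definition nijenhuis (R : realType) (n : nat) (M : atlas R n)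
    (K : tensor11 M) (X Y : vfield M) : vfield M := fun p =>
  bracket (tensor_app K X) (tensor_app K Y) p
  + K p (K p (bracket X Y p))
  - K p (bracket (tensor_app K X) Y p + bracket X (tensor_app K Y) p).

Definition torsion_free (R : realType) (n : nat) (M : atlas R n)
    (K : tensor11 M) : Prop :=
  forall X Y : vfield M, smooth_vfield X -> smooth_vfield Y ->
  forall p, nijenhuis K X Y p = 0.

Definition nonsingular (R : realType) (n : nat) (M : atlas R n)
    (K : tensor11 M) : Prop := forall p, lker (K p) = 0%VS.

Definition almost_tangent_structure (R : realType) (n : nat) (M : atlas R n)
    (K : tensor11 M) : Prop :=
  smooth_tensor11 K /\ forall p, lker (K p) = limg (K p).

Definition integrable_almost_tangent_structure (R : realType) (n : nat)
    (M : atlas R n) (K : tensor11 M) : Prop :=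
  almost_tangent_structure K /\ torsion_free K.

(* Pairs (q, v) with v in T_q Q. This is an alias because the product topology
   is not the right one: [chart_at q] need not depend continuously on q. *)
Definition tbundle_point (R : realType) (n : nat) (Q : atlas R n) : Type :=
  (Q * 'rV[R]_n)%type.

Definition tbundle_dom (R : realType) (n : nat) (Q : atlas R n) (i : index Q) :
    set (tbundle_point Q) := [set u | dom i u.1].

Definition tbundle_phi (R : realType) (n : nat) (Q : atlas R n) (i : index Q)
    (u : tbundle_point Q) : 'rV[R]_(n + n) :=
  row_mx (phi i u.1) (to_chart i u.1 u.2).

Definition tbundle_psi (R : realType) (n : nat) (Q : atlas R n) (i : index Q)
    (z : 'rV[R]_(n + n)) : tbundle_point Q :=
  (psi i (lsubmx z), of_chart i (psi i (lsubmx z)) (rsubmx z)).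

(* The topology making the charts homeomorphisms onto open sets. *)
Definition tbundle_subbase (R : realType) (n : nat) (Q : atlas R n) :
    set (set (tbundle_point Q)) :=
  [set U | exists i W, open W /\ U = tbundle_dom i `&` tbundle_phi i @^-1` W].

HB.instance Definition _ (R : realType) (n : nat) (Q : atlas R n) :=
  Choice.copy (tbundle_point Q) (Q * 'rV[R]_n)%type.
HB.instance Definition _ (R : realType) (n : nat) (Q : atlas R n) :=
  isSubBaseTopological.Build (tbundle_point Q) (@tbundle_subbase R n Q) id.

Definition tangent_bundle (R : realType) (n : nat) (Q : atlas R n) :
    atlas R (n + n) :=
  {| point := tbundle_point Q;
     index := index Q;
     dom := @tbundle_dom R n Q;
     phi := @tbundle_phi R n Q;
     psi := @tbundle_psi R n Q;
     chart_at := fun u : tbundle_point Q => chart_at u.1 |}.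

(* X^c = X^j d/dq^j + v^k (d X^j / d q^k) d/dv^j. *)
Definition complete_lift (R : realType) (n : nat) (Q : atlas R n)
    (X : vfield Q) : vfield (tangent_bundle Q) :=
  fun u : tbundle_point Q => let c := chart_at u.1 in
  row_mx (X u.1) ('D_(u.2) (vfield_rep X c) (phi c u.1)).

(* X^V = X^j d/dv^j. *)
Definition vertical_lift (R : realType) (n : nat) (Q : atlas R n)
    (X : vfield Q) : vfield (tangent_bundle Q) :=
  fun u : tbundle_point Q => row_mx 0 (X u.1).

Definition is_complete_lift_tensor (R : realType) (n : nat) (Q : atlas R n)
    (J : tensor11 Q) (Jc : tensor11 (tangent_bundle Q)) : Prop :=
  smooth_tensor11 Jc /\
  forall X : vfield Q, smooth_vfield X ->
    tensor_app Jc (complete_lift X) = complete_lift (tensor_app J X) /\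
    tensor_app Jc (vertical_lift X) = vertical_lift (tensor_app J X).

Definition is_vertical_endomorphism (R : realType) (n : nat) (Q : atlas R n)
    (S : tensor11 (tangent_bundle Q)) : Prop :=
  smooth_tensor11 S /\
  forall X : vfield Q, smooth_vfield X ->
    tensor_app S (complete_lift X) = vertical_lift X /\
    tensor_app S (vertical_lift X) = (fun=> 0).

(* Main.v *)
Require Import Defs.
From HB Require Import structures.
From mathcomp Require Import all_boot all_order all_algebra.
From mathcomp Require Import all_classical all_reals all_analysis.
From mathcomp Require Import ring lra.

(** A tangent vector of the tangent bundle at u = (p, v) is a pair (a, b) of row
    vectors in the coordinates of the chart chosen at p, and the whole theorem
    rests on one formula for K = Jc S, namely
      K_u (a, b) = (0, J_p a).
    The defining properties of S and Jc are stated on lifts of global vector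
    fields, so they determine the two tensors pointwise only because lifts span
    each tangent space: by [exists_vfield] a smooth vector field on Q can take
    any prescribed value at p, hence (a, b) is the sum of the complete lift of
    a field X with X_p = a and of the vertical lift of another field, which
    absorbs the derivative of X. This is where Hausdorffness enters: a bump
    function supported in a compact part of a chart extends smoothly by zero
    because that part is closed in Q.

    The formula gives K^2 = 0 at once, and, when every J_p is bijective,
    ker K = im K = (the vectors with a = 0). It also gives the torsion. Changes
    of charts of the tangent bundle are x, y |-> t x, dt_x y, with block
    triangular differential, so the formula has the same shape
    (a, b) |-> (0, M(x) a) in every chart, with M the local expression of J.
    Now write X1 for the first half of the components of a field X. As M does
    not depend on the fibre coordinates and K X is vertical,
      [K X, K Y] = (0, M (D_KX Y1 - D_KY X1)),
    while [K X, Y] and [X, K Y] have first halves D_KX Y1 and - D_KY X1, the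
    fields K X and K Y having none of their own. So K ([K X, Y] + [X, K Y])
    is equal to [K X, K Y], and K^2 [X, Y] = 0. *)

Set Implicit Arguments.
Unset Strict Implicit.
Unset Printing Implicit Defensive.

Import Order.TTheory GRing.Theory Num.Theory.
Import numFieldNormedType.Exports.

Local Open Scope classical_set_scope.
Local Open Scope ring_scope.

(** * Locality and product rule for differentials *)

Section differential.
Variables (R : realType) (V W : normedModType R).
Implicit Types f g : V -> W.

(** Differentials are defined through little-o expansions, so locality is checked
    first for a germ that vanishes; [near_eq_is_diff] adds the difference. *)
Lemma near0_is_diff f x : (\near x, f x = 0) -> is_diff x f 0.
Proof.
move=> f0; have fx0 := nbhs_singleton f0.
have fo : f \o shift x = cst (f x) + (\0 : {linear V -> W}) +o_ 0 id.
  apply/eqaddoP => _/posnumP[e].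
  move: f0; rewrite (near_shift 0) subr0 => f0; near=> y.
  rewrite /= opprD -![(_ + _ : _ -> _) _]/(_ + _) -![(- _ : _ -> _) _]/(- _).
  rewrite /cst /= fx0 !oppr0 !addr0.
  rewrite [f _](_ : _ = 0) ?normr0 ?mulr_ge0//.
  by near: y.
have c0 : continuous (\0 : V -> W) by exact: cst_continuous.
have d0 := @diff_unique _ _ _ f \0 x c0 fo.
by apply: DiffDef => //; apply/diff_locallyP; rewrite d0; split.
Unshelve. all: by end_near. Qed.

Lemma near_eq_is_diff f g df x : (\near x, f x = g x) ->
  is_diff x f df -> is_diff x g df.
Proof.
move=> fg dfx; have d0 : is_diff x (g - f) 0.
  apply: near0_is_diff; apply: filterS fg => y /= fgy.
  by rewrite -[(g - f) y]/(g y - f y) fgy subrr.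
have := is_diffD d0 dfx; rewrite add0r.
by rewrite (_ : g - f + f = g)// subrK.
Qed.

Lemma near_eq_differentiable f g x : (\near x, f x = g x) ->
  differentiable f x -> differentiable g x.
Proof. by move=> fg /differentiableP /(near_eq_is_diff fg) []. Qed.

Lemma near_eq_diff f g x v : (\near x, f x = g x) ->
  differentiable f x -> 'd f x v = 'd g x v.
Proof. by move=> fg /differentiableP /(near_eq_is_diff fg) [_ ->]. Qed.

Lemma is_diff_scale (f df : V -> R) g dg x :
  is_diff x f df -> is_diff x g dg ->
  is_diff x (fun y => f y *: g y) (fun v => f x *: dg v + df v *: g x).
Proof.
move=> dfx dgx.
have bil : bilinear_for
    (GRing.Scale.Law.clone _ _ *:%R _) (GRing.Scale.Law.clone _ _ *:%R _)
    (@GRing.scale R W).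
  split=> [w|a] b u v /=; first by rewrite scalerDl scalerA.
  by rewrite scalerDr !scalerA mulrC.
pose sM := bilinear_isBilinear.Build R R W W _ _ (@GRing.scale R W) bil.
pose s : {bilinear R -> W -> W} := HB.pack (@GRing.scale R W) sM.
have cs : continuous (fun p : R * W => s p.1 p.2) by exact: scale_continuous.
have dp := is_diff_pair dfx dgx.
have ds : is_diff (f x, g x) (fun p : R * W => s p.1 p.2)
    (fun q => s (f x) q.2 + s q.1 (g x)).
  by apply: DiffDef; [exact: differentiable_bilin|rewrite diff_bilin].
exact: (is_diff_comp dp ds).
Qed.

Lemma is_diff_sum I (r : seq I) (f df : I -> V -> W) x :
  (forall i, is_diff x (f i) (df i)) ->
  is_diff x (fun y => \sum_(i <- r) f i y) (fun v => \sum_(i <- r) df i v).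
Proof.
move=> dfx; elim: r => [|i r IH].
  have := is_diff_cst (0 : W) x.
  by congr (is_diff _ _ _); apply/funext => y; rewrite big_nil.
have := is_diffD (dfx i) IH.
by congr (is_diff _ _ _); apply/funext => y; rewrite big_cons.
Qed.

End differential.

Lemma diff_compE (R : realType) (U V W : normedModType R) (f : U -> V)
    (g : V -> W) x v : differentiable f x -> differentiable g (f x) ->
  'd (g \o f) x v = 'd g (f x) ('d f x v).
Proof. by move=> df dg; rewrite diff_comp. Qed.

(** * Calculus of maps of class C^k *)

Section Ck_calculus.
Variable R : realType.
Implicit Types V W U : normedModType R.

(** Openness of A is essential: on other sets the derivatives in [Ck_on] see values
    of f outside A. *)
Lemma Ck_on_ext V W (A : set V) k (f g : V -> W) : open A ->
  (forall x, A x -> f x = g x) -> Ck_on A k f -> Ck_on A k g.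
Proof.
move=> oA; elim: k f g => [|k IH] f g fg /=.
  move=> cf x Ax; have nfg : \near x, f x = g x.
    by near=> y; apply: fg; near: y; exact: open_nbhs_nbhs.
  rewrite /prop_for /continuous_at -(fg _ Ax).
  by apply: cvg_trans (cf x Ax); exact: near_eq_cvg.
have nfg x : A x -> \near x, f x = g x.
  by move=> Ax; near=> y; apply: fg; near: y; exact: open_nbhs_nbhs.
move=> [df Df]; split=> [x Ax|v].
  by apply: near_eq_differentiable (df x Ax); exact: nfg.
apply: IH (Df v) => x Ax; apply: near_eq_derive; exact: nfg.
Unshelve. all: by end_near. Qed.

(** Class C^k is a condition at each point separately, so any cover of A suffices,
    by sets that need not be contained in A. *)
Lemma Ck_on_local V W (A : set V) k (f : V -> W) :
  (forall x, A x -> exists2 B : set V, B x & Ck_on B k f) -> Ck_on A k f.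
Proof.
elim: k f => [|k IH] f /= H => [x Ax|].
  by have [B Bx /(_ x Bx)] := H x Ax.
split=> [x Ax|v]; first by have [B Bx [/(_ x Bx)]] := H x Ax.
by apply: IH => x Ax; have [B Bx [_ /(_ v)]] := H x Ax; exists B.
Qed.

Lemma Ck_onS V W (A : set V) k (f : V -> W) : Ck_on A k.+1 f -> Ck_on A k f.
Proof.
elim: k f => [|k IH] f [df Df]; last by split=> // v; exact/IH/Df.
by move=> x Ax; exact/differentiable_continuous/df.
Qed.

Lemma Ck_on_cst V W (A : set V) k (w : W) : Ck_on A k (cst w : V -> W).
Proof.
elim: k w => [|k IH] w /=; first by move=> x _; exact: cst_continuous.
split=> [x _|v]; first exact: differentiable_cst.
rewrite (_ : 'D_v (cst w) = cst 0); first exact: IH.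
by apply/funext => x; rewrite derive_cst.
Qed.

Lemma Ck_onD V W (A : set V) k (f g : V -> W) : open A ->
  Ck_on A k f -> Ck_on A k g -> Ck_on A k (fun x => f x + g x).
Proof.
move=> oA; elim: k f g => [|k IH] f g /=.
  by move=> cf cg x Ax; apply: cvgD; [exact: cf|exact: cg].
move=> [df Df] [dg Dg]; split=> [x Ax|v].
  by apply: differentiableD; [exact: df|exact: dg].
apply: (Ck_on_ext oA) (IH _ _ (Df v) (Dg v)) => x Ax.
by rewrite -deriveD//; apply: diff_derivable; [exact: df|exact: dg].
Qed.

Lemma Ck_on_sum V W (A : set V) k I (r : seq I) (f : I -> V -> W) : open A ->
  (forall i, Ck_on A k (f i)) -> Ck_on A k (fun x => \sum_(i <- r) f i x).
Proof.
move=> oA Cf; elim: r => [|i r IH].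
  rewrite (_ : (fun _ => _) = cst 0); first exact: Ck_on_cst.
  by apply/funext => x; rewrite big_nil.
rewrite (_ : (fun _ => _) = fun x => f i x + \sum_(i <- r) f i x).
  exact: Ck_onD.
by apply/funext => x; rewrite big_cons.
Qed.

Lemma Ck_onZ V W (A : set V) k (f : V -> R) (g : V -> W) : open A ->
  Ck_on A k f -> Ck_on A k g -> Ck_on A k (fun x => f x *: g x).
Proof.
move=> oA; elim: k f g => [|k IH] f g Cf Cg.
  by move=> x Ax; apply: cvgZ; [exact: Cf|exact: Cg].
have [df Df] := Cf; have [dg Dg] := Cg; split=> [x Ax|v].
  have dfx := differentiableP (df x Ax).
  by have [] := is_diff_scale dfx (differentiableP (dg x Ax)).
pose h x := f x *: 'D_v g x + 'D_v f x *: g x.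
apply: (@Ck_on_ext _ _ _ _ h) => //.
  move=> x Ax; have dfx := df x Ax; have dgx := dg x Ax.
  have [dfg dE] := is_diff_scale (differentiableP dfx) (differentiableP dgx).
  by rewrite deriveE// dE /h !deriveE.
apply: (Ck_onD oA); apply: IH; [exact: (Ck_onS Cf)|exact: Dg|exact: Df|].
exact: (Ck_onS Cg).
Qed.

Lemma Ck_on_linear V W (A : set V) k (L : {linear V -> W}) :
  continuous L -> Ck_on A k L.
Proof.
move=> cL; case: k => [|k] /=; first by move=> x _; exact: cL.
split=> [x _|v]; first exact: linear_differentiable.
rewrite (_ : 'D_v L = cst (L v)); first exact: Ck_on_cst.
by apply/funext => x; rewrite deriveE ?diff_lin//; exact: linear_differentiable.
Qed.

Lemma Ck_on_linear_comp V U W (A : set V) k (f : V -> U) (L : {linear U -> W}) :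
  open A -> continuous L -> Ck_on A k f -> Ck_on A k (L \o f).
Proof.
move=> oA cL; elim: k f => [|k IH] f /=.
  by move=> cf x Ax; apply: continuous_comp; [exact: cf|exact: cL].
move=> [df Df]; split=> [x Ax|v].
  by apply: differentiable_comp; [exact: df|exact: linear_differentiable].
apply: (Ck_on_ext oA) (IH _ (Df v)) => x Ax /=.
have dL := linear_differentiable (f x) cL.
rewrite [RHS]deriveE; last by apply: differentiable_comp; [exact: df|].
by rewrite diff_comp ?diff_lin//= ?deriveE//; exact: df.
Qed.

(** A finite basis e with its dual basis c. The notion is abstract so that one chain
    rule serves both row vectors and the scalars R. *)
Definition finite_coordinates U (m : nat) (e : 'I_m -> U)
    (c : 'I_m -> {linear U -> R}) :=
  (forall j, continuous (c j)) /\ forall u, u = \sum_j c j u *: e j.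

(** Since [Ck_on] speaks of derivatives in fixed directions, the induction needs the
    chain rule in the form D_v (g o f) = sum_j (D_v f)_j (D_(e j) g o f), whose
    terms are products of maps of class C^k. *)
Lemma Ck_on_comp V U W (A : set V) (B : set U) m (e : 'I_m -> U) c k
    (f : V -> U) (g : U -> W) : finite_coordinates e c ->
  open A -> (forall x, A x -> B (f x)) ->
  Ck_on A k f -> Ck_on B k g -> Ck_on A k (g \o f).
Proof.
move=> [cc ec] oA fAB; elim: k g => [|k IH] g Cf Cg.
  by move=> x Ax; apply: continuous_comp; [exact: Cf|exact/Cg/fAB].
have [df Df] := Cf; have [dg Dg] := Cg; split=> [x Ax|v].
  by apply: differentiable_comp; [exact: df|exact/dg/fAB].
apply: (@Ck_on_ext _ _ _ _
    (fun x => \sum_j c j ('D_v f x) *: 'D_(e j) g (f x))) => //.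
  move=> x Ax; have dfx := df x Ax; have dgx := dg _ (fAB x Ax).
  rewrite [RHS]deriveE; last exact: differentiable_comp.
  rewrite diff_comp//= [in RHS](ec ('d f x v)) linear_sum.
  by apply: eq_bigr => j _; rewrite linearZ !deriveE.
apply: Ck_on_sum => // j; apply: Ck_onZ => //.
  exact: (Ck_on_linear_comp oA (cc j) (Df v)).
exact: (IH _ (Ck_onS Cf) (Dg (e j))).
Qed.

End Ck_calculus.

(** * Row vectors *)

Section row_vectors.
Variable R : realType.

Lemma continuous_linear_rV n (W : normedModType R)
  (L : {linear 'rV[R]_n -> W}) : continuous L.
Proof.
have -> : (L : _ -> _) = fun v => \sum_j v 0 j *: L (delta_mx 0 j).
  apply/funext => v; rewrite [in LHS](row_sum_delta v) linear_sum.
  by apply: eq_bigr => j _; rewrite linearZ.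
apply: continuous_big => [|j _ v]; first exact: add_continuous.
by apply: cvgZr_tmp; [exact: nbhs_filter|exact: coord_continuous].
Qed.

Lemma is_diff_linear_rV n (W : normedModType R)
  (L : {linear 'rV[R]_n -> W}) v : is_diff v L L.
Proof.
have cL := @continuous_linear_rV n W L.
by apply: DiffDef; [exact: linear_differentiable|rewrite diff_lin].
Qed.

(** A named function, because it carries the structure of a linear form. *)
Definition row_coord n (k : 'I_n) (v : 'rV[R]_n) : R := v 0 k.

Fact row_coord_is_linear n (k : 'I_n) : linear (@row_coord n k).
Proof. by move=> a u v; rewrite /row_coord !mxE. Qed.

HB.instance Definition _ n (k : 'I_n) :=
  GRing.isLinear.Build R 'rV[R]_n R *:%R (@row_coord n k)
    (@row_coord_is_linear n k).

Lemma finite_coordinates_rV n :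
  finite_coordinates (fun k => delta_mx 0 k : 'rV[R]_n)
    (fun k => @row_coord n k).
Proof.
by split=> [k|v]; [exact: continuous_linear_rV|exact: row_sum_delta].
Qed.

Lemma diff_rV n (W : normedModType R) (f : 'rV[R]_n -> W) x v :
  differentiable f x ->
  'd f x v = \sum_k row_coord k v *: 'D_(delta_mx 0 k) f x.
Proof.
move=> df; rewrite [in LHS](row_sum_delta v) linear_sum.
by apply: eq_bigr => k _; rewrite linearZ deriveE.
Qed.

Definition row_injl m n : {linear 'rV[R]_m -> 'rV[R]_(m + n)} :=
  mulmxr (row_mx 1%:M 0).
Definition row_injr m n : {linear 'rV[R]_n -> 'rV[R]_(m + n)} :=
  mulmxr (row_mx 0 1%:M).

Lemma row_injrE m n (b : 'rV[R]_n) : row_injr m n b = row_mx 0 b.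
Proof. by rewrite /row_injr /= mul_mx_row mulmx0 mulmx1. Qed.

Lemma row_mx_inj m n (a : 'rV[R]_m) (b : 'rV[R]_n) :
  row_mx a b = row_injl m n a + row_injr m n b.
Proof.
rewrite row_injrE /row_injl /= mul_mx_row mulmx0 mulmx1.
by rewrite add_row_mx addr0 add0r.
Qed.

Lemma row_mx_is_diff m n (V : normedModType R) (f df : V -> 'rV[R]_m)
    (g dg : V -> 'rV[R]_n) x : is_diff x f df -> is_diff x g dg ->
  is_diff x (fun y => row_mx (f y) (g y)) (fun v => row_mx (df v) (dg v)).
Proof.
move=> dfx dgx.
have dl := is_diff_linear_rV (row_injl m n) (f x).
have dr := is_diff_linear_rV (row_injr m n) (g x).
have := is_diffD (is_diff_comp dfx dl) (is_diff_comp dgx dr).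
congr (is_diff _ _ _); apply/funext => v /=; symmetry; exact: row_mx_inj.
Qed.

End row_vectors.

(** * Bump functions *)

Section flat.
Variable R : realType.

(** The powers of 1 / t are there because they make the family closed under
    differentiation; [flat 0] is the usual exp (- 1 / t), extended by 0. *)
Definition flat (k : nat) (t : R) : R :=
  if 0 < t then t^-1 ^+ k * expR (- t^-1) else 0.

Lemma flat_le0 k (t : R) : t <= 0 -> flat k t = 0.
Proof. by rewrite leNgt /flat => /negPf ->. Qed.

(** From s ^ (k + 2) / (k + 2)! <= exp s at s = 1 / t. The exponent 2 on the right
    is what yields a zero derivative at the origin. *)
Lemma flat_le k (t : R) : `|flat k t| <= k.+2`!%:R * t ^+ 2.
Proof.
have [t0|t0] := leP t 0.
  by rewrite flat_le0// normr0 mulr_ge0// sqr_ge0.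
rewrite /flat t0 ger0_norm; last first.
  by rewrite mulr_ge0 ?expR_ge0// exprn_ge0// invr_ge0 ltW.
have s0 : 0 <= t^-1 by rewrite invr_ge0 ltW.
have := expR_ge1Dxn k.+1 s0; set s := t^-1 in s0 *.
rewrite expRN ler_pdivrMr ?expR_gt0// => sE.
have -> : s ^+ k = t ^+ 2 * s ^+ k.+2.
  by rewrite -[k.+2]add2n exprD mulrA -exprMn mulfV ?gt_eqF// expr1n mul1r.
rewrite [_%:R * _]mulrC -[leRHS]mulrA ler_wpM2l ?sqr_ge0//.
by rewrite -ler_pdivrMl ?ltr0n ?fact_gt0// mulrC (le_trans _ sE)// lerDr.
Qed.

Lemma is_derive_flat k (t : R) :
  is_derive t (1 : R) (flat k) (flat k.+2 t - k%:R * flat k.+1 t).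
Proof.
have [t0|t0|->] := ltrgt0P t.
- have nt : \near t, t^-1 ^+ k * expR (- t^-1) = flat k t.
    near=> s; rewrite /flat ifT//; near: s; exact: lt_nbhsr.
  apply: (near_eq_is_derive nt).
  have tn0 : t != 0 by rewrite gt_eqF.
  have dV : is_derive t (1 : R) (fun s : R => s^-1) (- t ^- 2).
    have := is_deriveV tn0 (is_derive_id t (1 : R)).
    by rewrite [_ *: _]mulr1.
  have dN : is_derive t (1 : R) (fun s : R => - s^-1) (t ^- 2).
    by have := is_deriveN dV; rewrite opprK.
  have dE := @is_derive1_comp _ expR (fun s => - s^-1) t _ _
    (is_derive_expR (- t^-1)) dN.
  have := is_deriveM (is_deriveX k dV) dE.
  rewrite (_ : _ * _ = fun s : R => s^-1 ^+ k * expR (- s^-1)); last first.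
    by apply/funext => s /=; rewrite fctE /= exprfctE.
  move=> dM; apply: (is_derive_eq dM).
  rewrite /flat t0 /= exprfctE -exprVn.
  case: k {nt dM} => [|k]; rewrite /= ?mul0r ?scale0r.
    rewrite scaler0 expr0 scale1r addr0 subr0; exact: mulrC.
  set E := expR _; set s := t^-1.
  transitivity (s ^+ k.+1 * (E * s ^+ 2) +
    E * ((k.+1%:R * s ^+ k) * - s ^+ 2)) => //.
  by rewrite !exprS; ring.
- have nt : \near t, 0 = flat k t.
    near=> s; rewrite flat_le0//; apply: ltW; near: s; exact: lt_nbhsl.
  rewrite !flat_le0 ?ltW// mulr0 subr0.
  by apply: (near_eq_is_derive nt); exact: is_derive_cst.
- rewrite !flat_le0// mulr0 subr0.
  have c0 : h^-1 *: ((flat k \o shift 0) (h *: (1 : R)) - flat k 0)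
      @[h --> 0^'] --> (0 : R).
    apply/cvgr0Pnorm_le => e e0; near=> h.
    rewrite /= [flat k 0]flat_le0// subr0 addr0 [h *: _]mulr1 normrZ.
    have h0 : h != 0 by near: h; exact: nbhs_dnbhs_neq.
    rewrite normfV ler_pdivrMl ?normr_gt0// (le_trans (flat_le _ _))//.
    rewrite -normr_id -[_ ^+ 2]ger0_norm ?sqr_ge0// normrX expr2 mulrA mulrC.
    rewrite normr_id.
    rewrite ler_wpM2l// mulrC -ler_pdivlMr ?ltr0n ?fact_gt0//.
    by near: h; apply: dnbhs0_le; rewrite divr_gt0// ltr0n fact_gt0.
  by apply: DeriveDef; [apply/cvg_ex; exists 0|exact: cvg_lim].
Unshelve. all: by end_near. Qed.

Lemma smooth_flat k : smooth_on setT (flat k).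
Proof.
move=> m; elim: m k => [|m IH] k.
  move=> t _; apply: differentiable_continuous; apply/derivable1_diffP.
  by have [] := is_derive_flat k t.
have dF s : differentiable (flat k) s.
  by apply/derivable1_diffP; have [] := is_derive_flat k s.
split=> // v.
rewrite (_ : 'D_v (flat k) =
    fun t => v *: flat k.+2 t + (- (v * k%:R)) *: flat k.+1 t).
  have oT : open (@setT R) by exact: openT.
  by apply: (Ck_onD oT); apply: (Ck_onZ oT) => //; exact: Ck_on_cst.
apply/funext => t; have [_ fE] := is_derive_flat k t.
rewrite deriveE// -[v]mulr1 linearZ /= -deriveE// fE mulr1 [LHS]mulrBr.
by rewrite scaleNr -[(v * _) *: _]mulrA.
Qed.

End flat.

Section bump.
Variables (R : realType) (n : nat).

Lemma finite_coordinates_R :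
  finite_coordinates (fun _ : 'I_1 => 1 : R)
    (fun _ : 'I_1 => idfun : {linear R -> R}).
Proof.
by split=> [_|u]; [move=> ?; exact: cvg_id|rewrite big_ord1 [RHS]mulr1].
Qed.

(** The function is exp (- 1 / s) with s = r^2 - |x - x0|^2 for the Euclidean norm,
    which is positive exactly on a ball contained in the cube of the conclusion. *)
Lemma exists_bump (x0 : 'rV[R]_n) (r : R) : 0 < r ->
  exists b : 'rV[R]_n -> R, [/\ smooth_on setT b, b x0 != 0 &
    forall x, b x != 0 -> forall k, `|x 0 k - x0 0 k| <= r].
Proof.
move=> r0; pose l k (x : 'rV[R]_n) : R := row_coord k x + - row_coord k x0.
(* The form of s follows the closure lemmas: sums of scalar multiples. *)
pose s x := r ^+ 2 + \sum_k (-1) *: (l k x *: l k x).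
have sE x : s x = r ^+ 2 - \sum_k l k x ^+ 2.
  by rewrite /s -sumrN; congr (_ + _); apply: eq_bigr => k _; rewrite scaleN1r.
exists (flat 0 \o s); split.
- move=> m; have oT : open (@setT 'rV[R]_n) := openT.
  apply: (@Ck_on_comp _ _ _ _ _ setT _ _ _ _ s (@flat R 0)
    finite_coordinates_R) => //.
    have Cl k : Ck_on setT m (l k).
      apply: (Ck_onD oT); last exact: Ck_on_cst.
      by apply: Ck_on_linear; exact: continuous_linear_rV.
    apply: (Ck_onD oT); first exact: Ck_on_cst.
    apply: (Ck_on_sum _ oT) => k; apply: (Ck_onZ oT) => //.
      exact: Ck_on_cst.
    exact: (Ck_onZ oT).
  exact: smooth_flat.
- rewrite /= sE big1 => [|k _]; last by rewrite /l subrr expr0n.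
  by rewrite subr0 /flat exprn_gt0// expr0 mul1r expR_eq0.
- move=> x bx k; have : 0 < s x.
    by rewrite ltNge; apply: contra bx => sx; rewrite /= flat_le0.
  rewrite sE subr_gt0 => /ltW le_r; rewrite -[_ - _]/(l k x).
  rewrite -(@ler_pXn2r _ 2)// ?nnegrE ?(ltW r0)// real_normK ?num_real//.
  apply: le_trans le_r; rewrite (bigD1 k)//= lerDl.
  by apply: sumr_ge0 => i _; exact: sqr_ge0.
Qed.

Lemma exists_bump_in (O : set 'rV[R]_n) x0 : open O -> O x0 ->
  exists (b : 'rV[R]_n -> R) (C : set 'rV[R]_n),
  [/\ smooth_on setT b, b x0 != 0, compact C, C `<=` O &
      forall x, b x != 0 -> C x].
Proof.
move=> oO Ox0; have : nbhs x0 O by apply: open_nbhs_nbhs.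
move=> /nbhs_ballP[e /= e0 eO]; have r0 : 0 < e / 2 by rewrite divr_gt0.
have [b [sb b0 bC]] := exists_bump x0 r0.
pose C := [set x : 'rV[R]_n | forall k,
  `[x0 0 k - e / 2, x0 0 k + e / 2]%classic (x ord0 k)].
exists b, C; split=> //.
- apply: (@rV_compact R n (fun k => `[x0 0 k - e / 2, x0 0 k + e / 2]%classic)).
  by move=> k; exact: segment_compact.
- move=> x Cx; apply: eO; split=> // i k; rewrite ord1.
  have := Cx k; rewrite /= in_itv /= => /andP[lo hi].
  rewrite /ball /= ltr_distlC.
  by apply/andP; split; lra.
- move=> x /bC xb k; rewrite /= in_itv /=.
  by have := xb k; rewrite ler_distlC => /andP[lo hi]; apply/andP; split; lra.
Qed.

End bump.

(** * Changes of charts on a manifold *)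

Section charts.
Variables (R : realType) (n : nat) (M : atlas R n).
Hypothesis hM : is_manifold M.
Implicit Types (i j k : Defs.index M) (p : M).

Lemma chart_image_open i (U : set M) : open U -> open (phi i @` (dom i `&` U)).
Proof.
move=> oU; rewrite openE => _ [p [ip Up] <-]; rewrite /interior.
have ix : (phi i @` dom i) (phi i p) by exists p.
have ni : nbhs (phi i p) (phi i @` dom i).
  by apply: open_nbhs_nbhs; split=> //; exact: phi_dom_open hM i.
have nU : nbhs (phi i p) (psi i @^-1` U).
  apply: (psi_continuous hM ix); rewrite (phiK hM ip).
  by apply: open_nbhs_nbhs; split.
apply: filterS (filterI ni nU) => _ [[q iq <-]]; rewrite /= (phiK hM iq) => Uq.
by exists q.
Qed.

Lemma overlap_open i j : open (phi i @` (dom i `&` dom j)).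
Proof. by apply: chart_image_open; exact: dom_open hM j. Qed.

Lemma near_overlap i j p : dom i p -> dom j p ->
  \forall x \near phi i p, (phi i @` (dom i `&` dom j)) x.
Proof.
by move=> ip jp; apply: open_nbhs_nbhs; split; [exact: overlap_open|exists p].
Qed.

Lemma transition_differentiable i j p : dom i p -> dom j p ->
  differentiable (phi j \o psi i) (phi i p).
Proof.
move=> ip jp; have [df _] := transition_smooth hM i j 1.
by apply: df; exists p.
Qed.

(** The chain rule for phi k o psi i = (phi k o psi j) o (phi j o psi i), an equality
    that holds near phi i p only. It makes components in different charts
    independent of the reference chart [chart_at p]. *)
Lemma transition_cocycle i j k p w : dom i p -> dom j p -> dom k p ->
  'd (phi k \o psi j) (phi j p) ('d (phi j \o psi i) (phi i p) w) =
  'd (phi k \o psi i) (phi i p) w.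
Proof.
move=> ip jp kp.
have di := transition_differentiable ip jp.
have jE : (phi j \o psi i) (phi i p) = phi j p by rewrite /= (phiK hM ip).
have dj : differentiable (phi k \o psi j) ((phi j \o psi i) (phi i p)).
  by rewrite jE; exact: transition_differentiable.
have dE := diff_compE w di dj; rewrite jE in dE.
transitivity ('d ((phi k \o psi j) \o (phi j \o psi i)) (phi i p) w).
  by symmetry; exact: dE.
have df := differentiable_comp di dj.
have nE : \forall x \near phi i p,
    ((phi k \o psi j) \o (phi j \o psi i)) x = (phi k \o psi i) x.
  apply: filterS (near_overlap ip jp) => _ [q [iq jq] <-].
  by rewrite /= (phiK hM iq) (phiK hM jq).
exact: (near_eq_diff w nE df).
Qed.

Lemma transition_id i p w : dom i p -> 'd (phi i \o psi i) (phi i p) w = w.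
Proof.
move=> ip; have dt := transition_differentiable ip ip.
have [_ idE] := is_diff_id (phi i p).
rewrite (near_eq_diff w _ dt (g := id)); first by rewrite idE.
apply: filterS (near_overlap ip ip) => _ [q [iq _] <-] /=.
by rewrite (phiK hM iq).
Qed.

Lemma to_chartE i p v :
  to_chart i p v = 'd (phi i \o psi (chart_at p)) (phi (chart_at p) p) v.
Proof. by rewrite /to_chart mul_rV_lin1. Qed.

Lemma of_chartE i p w :
  of_chart i p w = 'd (phi (chart_at p) \o psi i) (phi i p) w.
Proof. by rewrite /of_chart mul_rV_lin1. Qed.

Lemma to_of_chart i j p w : dom i p -> dom j p ->
  to_chart j p (of_chart i p w) = 'd (phi j \o psi i) (phi i p) w.
Proof.
move=> ip jp; rewrite to_chartE of_chartE.
exact: transition_cocycle w ip (dom_chart_at hM p) jp.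
Qed.

Lemma of_chartK i p w : dom i p -> to_chart i p (of_chart i p w) = w.
Proof. by move=> ip; rewrite to_of_chart//; exact: transition_id. Qed.

Lemma to_chartK i p v : dom i p -> of_chart i p (to_chart i p v) = v.
Proof.
move=> ip; have cp := dom_chart_at hM p.
rewrite to_chartE of_chartE (transition_cocycle v cp ip cp).
exact: transition_id.
Qed.

Lemma to_chart_at p v : to_chart (chart_at p) p v = v.
Proof. by rewrite to_chartE; apply: transition_id; exact: dom_chart_at hM p. Qed.

Lemma of_chart_at p v : of_chart (chart_at p) p v = v.
Proof.
by rewrite -{1}(to_chart_at p v) to_chartK//; exact: dom_chart_at hM p.
Qed.

End charts.

(** * Vector fields with a prescribed value *)

Section global_fields.
Variables (R : realType) (n : nat) (M : atlas R n).
Hypothesis hM : is_manifold M.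

(** Take a field constant in the chart at p, multiply it by a bump function whose
    support lies in a compact C of that chart, and extend it by 0. The image of C in
    M is compact, hence closed as M is Hausdorff, so that the extension is smooth
    also at the boundary of the chart domain. *)
Lemma exists_vfield (p : M) (v : 'rV[R]_n) :
  exists2 X : vfield M, smooth_vfield X & X p = v.
Proof.
set j := chart_at p; have jp : dom j p := dom_chart_at hM p.
have [|b [C [sb b0 cC CO bC]]] :=
    exists_bump_in (@phi_dom_open _ _ _ hM j) (x0 := phi j p).
  by exists p.
pose a := (b (phi j p))^-1 *: v.
pose X : vfield M := fun q =>
  if `[<dom j q>] then b (phi j q) *: of_chart j q a else 0.
exists X; last first.
  by rewrite /X asboolT// (of_chart_at hM) scalerA mulfV// scale1r.
have clC : closed (psi j @` C).
  apply: compact_closed (manifold_hausdorff hM) _.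
  apply: continuous_compact cC; apply: continuous_in_subspaceT => x /set_mem /CO.
  by move=> jx; exact: (@psi_continuous _ _ _ hM j x jx).
move=> i m; apply: Ck_on_local => _ [q iq <-].
have [jq|njq] := pselect (dom j q).
  (* In chart i the field is (b o t) times the derivative of the inverse transition
     along a, taken at t x. *)
  exists (phi i @` (dom i `&` dom j)); first by exists q.
  have oij := @overlap_open _ _ _ hM i j.
  pose t := phi j \o psi i.
  have Ct : Ck_on (phi i @` (dom i `&` dom j)) m t.
    exact: transition_smooth hM i j m.
  apply: (@Ck_on_ext _ _ _ _ _
      (fun x => (b \o t) x *: ('D_a (phi i \o psi j) \o t) x) _ oij).
    move=> _ [q' [iq' jq'] <-]; rewrite /vfield_rep /t /= (phiK hM iq').
    rewrite /X asboolT//.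
    rewrite [in RHS]/to_chart -scalemxAl -[X in _ = _ *: X]/(to_chart i q' _).
    congr (_ *: _); rewrite (to_of_chart hM _ jq' iq') deriveE//.
    exact: transition_differentiable.
  apply: (Ck_onZ oij).
    by apply: (Ck_on_comp (finite_coordinates_rV R n) oij _ Ct (sb m)).
  have [_ Dt] := transition_smooth hM j i m.+1.
  apply: (Ck_on_comp (finite_coordinates_rV R n) oij _ Ct (Dt a)).
  move=> _ [q' [iq' jq'] <-]; exists q' => //.
  by rewrite /t /= (phiK hM iq').
(* Outside the chart at p, the field is zero near q. *)
have oC : open (~` (psi j @` C)) by exact: closed_openC.
exists (phi i @` (dom i `&` ~` (psi j @` C))).
  exists q => //; split=> // -[x /CO[q' jq' <-]]; rewrite (phiK hM jq') => qq'.
  by apply: njq; rewrite -qq'.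
apply: (@Ck_on_ext _ _ _ _ _ (cst 0)); first exact: chart_image_open hM i _ oC.
  move=> _ [q' [iq' Cq'] <-]; rewrite /vfield_rep (phiK hM iq') /X.
  case: asboolP => [jq'|_]; last by rewrite /to_chart mul0mx.
  have [->|/bC Cx] := eqVneq (b (phi j q')) 0.
    by rewrite scale0r /to_chart mul0mx.
  by exfalso; apply: Cq'; exists (phi j q') => //; rewrite (phiK hM jq').
exact: Ck_on_cst.
Qed.

End global_fields.

(** * Changes of charts on the tangent bundle *)

Section tangent_charts.
Variables (R : realType) (n : nat) (Q : atlas R n).
Hypothesis hQ : is_manifold Q.
Implicit Types (i j : Defs.index Q) (p : Q).

Lemma tbundle_transitionE i j (z : 'rV[R]_(n + n)) :
  (phi i @` (dom i `&` dom j)) (lsubmx z) ->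
  tbundle_phi j (tbundle_psi i z) =
  row_mx ((phi j \o psi i) (lsubmx z))
    (\sum_k row_coord k (rsubmx z) *:
       'D_(delta_mx 0 k) (phi j \o psi i) (lsubmx z)).
Proof.
move=> [q [iq jq] qz]; rewrite /tbundle_phi /tbundle_psi /= -qz (phiK hQ iq).
congr row_mx; rewrite (to_of_chart hQ _ iq jq).
have dt := transition_differentiable hQ iq jq.
exact: diff_rV dt.
Qed.

(** The differential of (x, y) |-> (t x, dt_x y) is block triangular with both diagonal
    blocks equal to dt_x. The remaining block is a second derivative of t; it stays
    hidden in d, which the rest of the proof evaluates on vertical vectors only. *)
Lemma tbundle_transition_is_diff i j p (y : 'rV[R]_n) : dom i p -> dom j p ->
  exists2 d : 'rV[R]_(n + n) -> 'rV[R]_n,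
  is_diff (row_mx (phi i p) y) (tbundle_phi j \o @tbundle_psi R n Q i)
    (fun w => row_mx ('d (phi j \o psi i) (phi i p) (lsubmx w)) (d w)) &
  forall b, d (row_mx 0 b) = 'd (phi j \o psi i) (phi i p) b.
Proof.
move=> ip jp; set t := phi j \o psi i; set z := row_mx (phi i p) y.
have dt := transition_differentiable hQ ip jp.
have dl : is_diff z (fun w => lsubmx w) (fun w => lsubmx w).
  exact: (is_diff_linear_rV (@lsubmx R 1 n n) z).
have dr : is_diff z (fun w => rsubmx w) (fun w => rsubmx w).
  exact: (is_diff_linear_rV (@rsubmx R 1 n n) z).
have lz : lsubmx z = phi i p by rewrite row_mxKl.
have d1 : is_diff z (t \o @lsubmx R 1 n n) ('d t (phi i p) \o @lsubmx R 1 n n).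
  have dt' : is_diff (lsubmx z) t ('d t (phi i p)).
    by rewrite lz; exact: differentiableP dt.
  exact: is_diff_comp dl dt'.
have [_ Dt] := transition_smooth hQ i j 2.
have dD k : differentiable ('D_(delta_mx 0 k) t) (phi i p).
  by have [dDt _] := Dt (delta_mx 0 k); apply: dDt; exists p.
have dk k : is_diff z
    (fun w => row_coord k (rsubmx w) *: 'D_(delta_mx 0 k) t (lsubmx w))
    (fun w =>
       row_coord k (rsubmx z) *: 'd ('D_(delta_mx 0 k) t) (phi i p) (lsubmx w)
       + row_coord k (rsubmx w) *: 'D_(delta_mx 0 k) t (phi i p)).
  have dc := is_diff_comp dr (is_diff_linear_rV (@row_coord R n k) (rsubmx z)).
  have dD' : is_diff (lsubmx z) ('D_(delta_mx 0 k) t)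
      ('d ('D_(delta_mx 0 k) t) (phi i p)).
    rewrite lz; exact: differentiableP (dD k).
  have := is_diff_scale dc (is_diff_comp dl dD').
  by rewrite /comp /= lz.
have d2 := is_diff_sum (index_enum _) dk.
eexists.
  apply: (near_eq_is_diff _ (row_mx_is_diff d1 d2)).
  have nz : \forall w \near z, (phi i @` (dom i `&` dom j)) (lsubmx w).
    apply: (@continuous_lsubmx _ _ _ _ z); rewrite lz.
    exact: near_overlap hQ _ _ _ ip jp.
  by apply: filterS nz => w wz; symmetry; exact: tbundle_transitionE.
move=> b.
transitivity (\sum_k row_coord k b *: 'D_(delta_mx 0 k) t (phi i p)).
  apply: eq_bigr => k _.
  have d0 : 'd ('D_(delta_mx 0 k) t) (phi i p)
      (lsubmx (row_mx (0 : 'rV[R]_n) b)) = 0.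
    by rewrite row_mxKl; exact: linear0.
  by rewrite d0 scaler0 add0r row_mxKr.
symmetry; exact: diff_rV dt.
Qed.

End tangent_charts.

(** * Tensors that send (a, b) to (0, J a) *)

Section vertical_tensor.
Variables (R : realType) (n : nat) (Q : atlas R n).
Hypothesis hQ : is_manifold Q.
Implicit Types (i : Defs.index Q) (p : Q) (u : tbundle_point Q).

Local Notation TQ := (tangent_bundle Q).
Local Notation Tto_chart := (@to_chart R (n + n) TQ).
Local Notation Tphi := (@phi R (n + n) TQ).
Local Notation Tdom := (@dom R (n + n) TQ).
Local Notation Tof_chart := (@of_chart R (n + n) TQ).

Lemma tbundle_to_chart i u : dom i u.1 ->
  (forall w, lsubmx (Tto_chart i u w) = to_chart i u.1 (lsubmx w)) /\
  forall b, Tto_chart i u (row_mx 0 b) = row_mx 0 (to_chart i u.1 b).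
Proof.
move=> iu; have cu := dom_chart_at hQ u.1.
have [d [_ dE] d0] := tbundle_transition_is_diff hQ
  (to_chart (chart_at u.1) u.1 u.2) cu iu.
have tE w : Tto_chart i u w = row_mx (to_chart i u.1 (lsubmx w)) (d w).
  rewrite !to_chartE.
  exact: (congr1 (@^~ w) dE).
split=> [w|b]; first by rewrite tE row_mxKl.
rewrite tE row_mxKl d0 !to_chartE; congr row_mx; exact: linear0.
Qed.

Lemma lsubmx_tbundle_of_chart i u w : dom i u.1 ->
  lsubmx (Tof_chart i u w) = of_chart i u.1 (lsubmx w).
Proof.
move=> iu; have cu := dom_chart_at hQ u.1.
have [d [_ dE] d0] := tbundle_transition_is_diff hQ
  (to_chart i u.1 u.2) iu cu.
rewrite !of_chartE.
have -> := congr1 (@^~ w) dE.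
by rewrite row_mxKl.
Qed.

Lemma tbundle_chart_image i :
  Tphi i @` Tdom i = lsubmx @^-1` (phi i @` dom i).
Proof.
apply/seteqP; split=> [_ [u iu <-]|z [p ip pz]].
  by exists u.1 => //; rewrite row_mxKl.
exists (p, of_chart i p (rsubmx z)) => //=.
by rewrite /tbundle_phi /= of_chartK// pz hsubmxK.
Qed.

Lemma tbundle_chart_image_open i :
  open (Tphi i @` Tdom i).
Proof.
rewrite tbundle_chart_image; apply: open_comp; last exact: phi_dom_open hQ i.
by move=> z _; exact: continuous_lsubmx.
Qed.

Variables (J : tensor11 Q) (K : tensor11 TQ).
Hypothesis hJ : smooth_tensor11 J.
Hypothesis KE : forall u w, K u w = row_mx 0 (J u.1 (lsubmx w)).

(** The matrix of J in the chart i, in the form used by [smooth_tensor11]. *)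
Definition tensor_rep i (x a : 'rV[R]_n) : 'rV[R]_n :=
  to_chart i (psi i x) (J (psi i x) (of_chart i (psi i x) a)).

Lemma tensor_rep_is_linear i x : linear (tensor_rep i x).
Proof.
move=> b a a'; rewrite /tensor_rep /of_chart mulmxDl -scalemxAl linearP.
by rewrite /to_chart mulmxDl -scalemxAl.
Qed.

HB.instance Definition _ i x :=
  GRing.isLinear.Build R 'rV[R]_n 'rV[R]_n *:%R (tensor_rep i x)
    (@tensor_rep_is_linear i x).

(** K keeps its shape (a, b) |-> (0, J a) in every chart, with the expression of J in
    the underlying chart of Q, which is smooth by hypothesis on J. *)
Lemma smooth_vertical_tensor : smooth_tensor11 K.
Proof.
move=> i w k; change (Defs.index Q) in i.
have cl := @continuous_linear_rV _ _ _ (@lsubmx R 1 n n).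
have cr := @continuous_linear_rV _ _ _ (row_injr R n n).
pose g : 'rV[R]_(n + n) -> 'rV[R]_n :=
  (fun x => tensor_rep i x (lsubmx w)) \o @lsubmx R 1 n n.
apply: (@Ck_on_ext _ _ _ _ _ (row_injr R n n \o g)).
  exact: tbundle_chart_image_open.
  move=> z; rewrite tbundle_chart_image => iz.
  have iu : dom i (@psi R n Q i (lsubmx z)).
    by case: iz => p ip <-; rewrite phiK.
  set u : tbundle_point Q := @psi R (n + n) TQ i z.
  have iu' : dom i u.1 by exact: iu.
  rewrite KE (tbundle_to_chart iu').2 (lsubmx_tbundle_of_chart _ iu').
  by rewrite -row_injrE.
refine (@Ck_on_linear_comp R _ _ _ _ k g (row_injr R n n)
  (@tbundle_chart_image_open i) cr _).
apply: (@Ck_on_comp _ _ _ _ _ (phi i @` dom i) _ _ _ _ (@lsubmx R 1 n n)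
  (fun x => tensor_rep i x (lsubmx w)) (finite_coordinates_rV R n)).
- exact: tbundle_chart_image_open.
- by move=> z; rewrite tbundle_chart_image.
- exact: Ck_on_linear.
- exact: hJ.
Qed.

Lemma vfield_rep_vertical (X : vfield TQ) i z :
  (phi i @` dom i) (lsubmx z) ->
  vfield_rep (tensor_app K X) i z =
  row_mx 0 (tensor_rep i (lsubmx z) (lsubmx (vfield_rep X i z))).
Proof.
move=> [p ip pz].
rewrite /vfield_rep; set u : tbundle_point Q := @psi R (n + n) TQ i z.
have uE : u.1 = psi i (lsubmx z) by [].
have iu : dom i u.1 by rewrite uE -pz phiK.
rewrite /tensor_app KE (tbundle_to_chart iu).2 (tbundle_to_chart iu).1.
by rewrite /tensor_rep -uE (to_chartK hQ _ iu).
Qed.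

Lemma tensor_rep_at p a :
  tensor_rep (chart_at p) (phi (chart_at p) p) a = J p a.
Proof.
have cp := dom_chart_at hQ p; rewrite /tensor_rep phiK// to_chart_at//.
by rewrite (of_chart_at hQ).
Qed.

Lemma vfield_rep_differentiable (X : vfield TQ) u :
  smooth_vfield X ->
  differentiable (vfield_rep X (chart_at u.1)) (Tphi (chart_at u.1) u).
Proof.
move=> sX; have [dX _] := sX (chart_at u.1) 1.
by apply: dX; exists u => //; exact: dom_chart_at hQ u.1.
Qed.

(** With M = [tensor_rep] and X1 the first half of X in the chart, K X is (0, M(x) X1).
    Its derivative has no first half, and along the fibre only X1 is differentiated
    since M does not depend on the fibre coordinates. *)
Lemma vertical_rep_is_diff (X : vfield TQ) u :
  smooth_vfield X ->
  exists2 d : 'rV[R]_(n + n) -> 'rV[R]_n,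
  is_diff (Tphi (chart_at u.1) u)
    (vfield_rep (tensor_app K X) (chart_at u.1))
    (fun w => row_mx 0 (d w)) &
  forall b, d (row_mx 0 b) = J u.1
    (lsubmx ('D_(row_mx 0 b) (vfield_rep X (chart_at u.1))
               (Tphi (chart_at u.1) u))).
Proof.
move=> sX; have dX := vfield_rep_differentiable u sX.
set c := chart_at u.1 in dX *; set z := Tphi c u in dX *.
set P := vfield_rep X c in dX *.
have [D dP DE] : exists2 D : 'rV[R]_(n + n) -> 'rV[R]_(n + n),
    is_diff z P D & forall w, 'D_w P z = D w.
  exists ('d P z : _ -> _); first exact: differentiableP.
  by move=> w; exact: deriveE.
set p := u.1; have cp : dom c p := dom_chart_at hQ p.
have lz : lsubmx z = phi c p by rewrite row_mxKl.
have dl v : is_diff v (fun w : 'rV[R]_(n + n) => lsubmx w) (fun w => lsubmx w).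
  exact: (is_diff_linear_rV (@lsubmx R 1 n n) v).
pose e k : 'rV[R]_n := delta_mx 0 k.
pose DJ k : 'rV[R]_n -> 'rV[R]_n :=
  'd (fun x => tensor_rep c x (e k)) (phi c p).
have dJ k : is_diff (lsubmx z) (fun x => tensor_rep c x (e k)) (DJ k).
  rewrite lz; apply: differentiableP.
  by have [dJ _] := hJ c (e k) 1; apply: dJ; exists p.
have DJ0 k : DJ k 0 = 0 by exact: linear0.
(* Nothing else about the derivative of J is relevant: along a vertical vector the
   base point does not move. *)
clearbody DJ.
have dk k : is_diff z
    (fun w => row_coord k (lsubmx (P w)) *: tensor_rep c (lsubmx w) (e k))
    (fun w => row_coord k (lsubmx (P z)) *: DJ k (lsubmx w)
              + row_coord k (lsubmx (D w)) *: tensor_rep c (lsubmx z) (e k)).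
  have dc := is_diff_comp (is_diff_comp dP (dl (P z)))
    (is_diff_linear_rV (@row_coord R n k) (lsubmx (P z))).
  exact: (is_diff_scale dc (is_diff_comp (dl z) (dJ k))).
have d2 := is_diff_sum (index_enum _) dk.
eexists.
  apply: (near_eq_is_diff _ (row_mx_is_diff (is_diff_cst 0 z) d2)).
  have nz : \forall w \near z, (phi c @` dom c) (lsubmx w).
    apply: (@continuous_lsubmx _ _ _ _ z); rewrite lz.
    by apply: open_nbhs_nbhs; split; [exact: phi_dom_open hQ _|exists p].
  apply: filterS nz => w wz.
  rewrite (vfield_rep_vertical X wz); congr row_mx.
  rewrite [in RHS](row_sum_delta (lsubmx (P w))) linear_sum.
  by apply: eq_bigr => k _; rewrite linearZ.
move=> b; rewrite DE -tensor_rep_at -lz; set a := lsubmx (D _).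
transitivity (\sum_k row_coord k a *: tensor_rep c (lsubmx z) (e k)).
  apply: eq_bigr => k _.
  by rewrite row_mxKl DJ0 scaler0 add0r.
rewrite [in RHS](row_sum_delta a) linear_sum.
by apply: eq_bigr => k _; rewrite linearZ.
Qed.

(** The two terms of [K X, K Y] are those of K ([K X, Y] + [X, K Y]): in the latter,
    the derivatives of K X and K Y have zero first half and are killed by K. *)
Lemma vertical_torsion_free : torsion_free K.
Proof.
move=> X Y sX sY u; rewrite /nijenhuis /bracket.
have [dX [dXe dXE] dX0] := vertical_rep_is_diff u sX.
have [dY [dYe dYE] dY0] := vertical_rep_is_diff u sY.
have XE w : 'D_w (vfield_rep (tensor_app K X) (chart_at u.1))
    (Tphi (chart_at u.1) u) = row_mx 0 (dX w).
  rewrite deriveE//; exact: (congr1 (@^~ w) dXE).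
have YE w : 'D_w (vfield_rep (tensor_app K Y) (chart_at u.1))
    (Tphi (chart_at u.1) u) = row_mx 0 (dY w).
  rewrite deriveE//; exact: (congr1 (@^~ w) dYE).
rewrite !XE !YE.
have KXE Z : tensor_app K Z u = row_mx 0 (J u.1 (lsubmx (Z u))) by exact: KE.
rewrite !KXE dX0 dY0 !KE.
(* a and b are the derivatives of Y along K X and of X along K Y. *)
set a := 'D_(row_mx _ _) _ _; set b := 'D_(row_mx _ _) _ _.
rewrite !row_mxKl linear0 row_mx0 addr0.
have lE v w v' w' : lsubmx (v - row_mx 0 w + (row_mx 0 w' - v')) =
    lsubmx v - lsubmx v' :> 'rV[R]_n.
  by rewrite !linearD !linearN /= !row_mxKl subr0 add0r.
rewrite lE linearB /= opp_row_mx add_row_mx opp_row_mx add_row_mx.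
by rewrite oppr0 !addr0 subrr row_mx0.
Qed.

End vertical_tensor.

(** * Pointwise values of the lifted tensors *)

Section lifted_tensors.
Variables (R : realType) (n : nat) (Q : atlas R n).
Hypothesis hQ : is_manifold Q.
Local Notation TQ := (tangent_bundle Q).

(** Any vector at u is the value of X^c + Y^V for suitable global fields: X has the
    given first half, and Y makes up for the derivative of X in the second half
    of X^c. Then S maps this sum to X^V. *)
Lemma vertical_endomorphismE (S : tensor11 TQ) (u : tbundle_point Q) w :
  is_vertical_endomorphism S -> S u w = row_mx 0 (lsubmx w).
Proof.
move=> [_ hS]; rewrite -[w in LHS]hsubmxK.
have [X sX Xp] := exists_vfield hQ u.1 (lsubmx w).
set d := 'D_(u.2) (vfield_rep X (chart_at u.1)) (phi (chart_at u.1) u.1).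
have [Y sY Yp] := exists_vfield hQ u.1 (rsubmx w - d).
have [SX _] := hS X sX; have [_ SY] := hS Y sY.
have -> : row_mx (lsubmx w) (rsubmx w) = complete_lift X u + vertical_lift Y u.
  by rewrite /complete_lift /vertical_lift Xp Yp add_row_mx addr0 addrC subrK.
rewrite linearD /= -[S u _]/(tensor_app S (complete_lift X) u) SX.
rewrite -[S u _]/(tensor_app S (vertical_lift Y) u) SY addr0.
by rewrite /vertical_lift Xp.
Qed.

Lemma complete_lift_tensor_vertical (J : tensor11 Q) (Jc : tensor11 TQ)
    (u : tbundle_point Q) b : is_complete_lift_tensor J Jc ->
  Jc u (row_mx 0 b) = row_mx 0 (J u.1 b).
Proof.
move=> [_ hJc]; have [X sX Xp] := exists_vfield hQ u.1 b.
have [_ JX] := hJc X sX; have := congr1 (@^~ u) JX.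
by rewrite /tensor_app /vertical_lift /= Xp.
Qed.

End lifted_tensors.

Theorem lemma1 (R : realType) (n : nat) (Q : atlas R n) (hQ : is_manifold Q)
    (J : tensor11 Q) (hJ : smooth_tensor11 J)
    (Jc : tensor11 (tangent_bundle Q)) (hJc : is_complete_lift_tensor J Jc)
    (S : tensor11 (tangent_bundle Q)) (hS : is_vertical_endomorphism S) :
  (forall u, tensor_comp (tensor_comp Jc S) (tensor_comp Jc S) u = 0%R) /\
  torsion_free (tensor_comp Jc S) /\
  (nonsingular J -> integrable_almost_tangent_structure (tensor_comp Jc S)).
Proof.
have KE u w : tensor_comp Jc S u w = row_mx 0 (J u.1 (lsubmx w)).
  rewrite /tensor_comp comp_lfunE (vertical_endomorphismE hQ u w hS).
  exact (complete_lift_tensor_vertical hQ u _ hJc).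
have KK u w : tensor_comp Jc S u (tensor_comp Jc S u w) = 0.
  by rewrite !KE row_mxKl linear0 row_mx0.
have tK : torsion_free (tensor_comp Jc S) := vertical_torsion_free hQ hJ KE.
split; first by move=> u; apply/lfunP => w; rewrite comp_lfunE KK zero_lfunE.
split=> // nsJ; split=> //; split; first exact (smooth_vertical_tensor hQ hJ KE).
move=> u; have J0 : lker (J u.1) == 0%VS by apply/eqP; exact: nsJ.
(* Both spaces consist of the vertical vectors: J is injective on first halves, and
   a vertical vector (0, c) is the image of (J^-1 c, 0). *)
apply/vspaceP => w; rewrite memv_ker.
apply/eqP/memv_imgP => [|[v _ ->]]; last exact: KK.
rewrite KE => Jw; have lw : lsubmx w = 0.
  apply: (lker0P J0); rewrite linear0.
  by move/(congr1 rsubmx): Jw; rewrite row_mxKr linear0.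
exists (row_mx ((J u.1)^-1%VF (rsubmx w)) 0); first exact: memvf.
by rewrite KE row_mxKl lker0_lfunVK// -[w in LHS]hsubmxK lw.
Qed.
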